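(* Let $1\le m\le n-1$ be integers and let $p$ be a prime large enough that $$p^{m(n-m)}\le \binom{n}{m}_p\le 2\,p^{m(n-m)}.$$ Let $E\subset \mathbb{F}_p^n$ be a non-empty set. Then: (a) for every real number $N$ with $0\le N<\frac12|E|$, $$\left|\{W\in G(n,n-m): |\pi^{W}(E)|\le N\}\right|\le 4\,p^{(n-m)m-m}\,N;$$ (b) for every $\delta\in(0,1)$, $$\left|\{W\in G(n,n-m): |\pi^{W}(E)|\le \delta p^{m}\}\right|\le 2\left(\frac{\delta}{1-\delta}\right)p^{m(n-m)+m}\,|E|^{-1}.$$
   Context: $\mathbb{F}_p$ is the field with $p$ elements ($p$ prime). $|J|$ denotes the cardinality of a finite set $J$. $G(n,k)$ denotes the set of all $k$-dimensional linear subspaces of $\mathbb{F}_p^n$. The Gaussian binomial coefficient is $$\binom{n}{m}_p=\frac{(p^n-1)(p^n-p)\cdots(p^n-p^{m-1})}{(p^m-1)(p^m-p)\cdots(p^m-p^{m-1})}=|G(n,m)|.$$ For a subspace $W$ of $\mathbb{F}_p^n$ and $E\subset\mathbb{F}_p^n$, $\pi^W(E)$ is the set of cosets of $W$ that meet $E$: $$\pi^{W}(E)=\{x+W: x\in\mathbb{F}_p^n,\ E\cap(x+W)\ne\emptyset\}.$$ *)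

(* Defs.v *)
From HB Require Import structures.
From mathcomp Require Import all_boot all_order all_algebra all_field.
From mathcomp Require Import reals.

Set Implicit Arguments.
Unset Strict Implicit.
Unset Printing Implicit Defensive.

Import Order.TTheory GRing.Theory Num.Theory.
Local Open Scope ring_scope.

(* The library makes {vspace vT} a choiceType only; over a finite field its
   encoding by square matrices makes it finite, which allows cardinals. *)
Section FiniteVspace.
Import VectorInternalTheory.
HB.instance Definition _ (F : finFieldType) (vT : vectType F) :=
  [Countable of {vspace vT} by <:].
HB.instance Definition _ (F : finFieldType) (vT : vectType F) :=
  [Finite of {vspace vT} by <:].
End FiniteVspace.

Definition Grass (p n k : nat) : {set {vspace 'rV['F_p]_n}} :=
  [set W : {vspace 'rV['F_p]_n} | \dim W == k].

(* Computed in R, so that neither the subtractions nor the division truncate. *)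
Definition gauss_binom (R : realType) (p n m : nat) : R :=
  (\prod_(i < m) (p%:R ^+ n - p%:R ^+ i)) /
  (\prod_(i < m) (p%:R ^+ m - p%:R ^+ i)).

Definition translate (p n : nat) (W : {vspace 'rV['F_p]_n})
    (x : 'rV['F_p]_n) : {set 'rV['F_p]_n} :=
  [set x + w | w in W].

Definition proj_cosets (p n : nat) (W : {vspace 'rV['F_p]_n})
    (E : {set 'rV['F_p]_n}) : {set {set 'rV['F_p]_n}} :=
  [set translate W x | x : 'rV['F_p]_n & E :&: translate W x != set0].

(* Main.v *)
(* For W of dimension n - m let e(W) be the number of pairs (x, y) in E x E with
   x - y in W.  Cauchy-Schwarz over the cosets of W gives
   |E|^2 <= |pi^W(E)| e(W), so a small projection forces many pairs.  GL_n acts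
   transitively on nonzero vectors, so each of them lies in a proportion
   (p^(n-m) - 1) / (p^n - 1) <= p^-m of these W, and this controls the sum of
   the e(W).  Part (a) then follows from Markov's inequality applied to
   e(W) - |E| (the off-diagonal pairs), part (b) from the same applied to
   e(W) - |E|^2 / p^m. *)
From HB Require Import structures.
Require Import Defs.
From mathcomp Require Import all_boot all_order all_algebra all_field zify ring lra.
From mathcomp Require Import reals.

Set Implicit Arguments.
Unset Strict Implicit.
Unset Printing Implicit Defensive.

Import Order.TTheory GRing.Theory Num.Theory.
Local Open Scope ring_scope.

(** * Counting matrices of full rank and subspaces of given codimension *)

Lemma row_free_col_mx (F : fieldType) (m n : nat) (u : 'rV[F]_n)
    (B : 'M[F]_(m, n)) :
  row_free (col_mx u B) = row_free B && ~~ (u <= B)%MS.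
Proof.
rewrite /row_free -addsmxE.
have leD : (\rank (u + B)%MS <= 1 + \rank B)%N.
  apply: leq_trans (mxrank_adds_leqif u B) _.
  by rewrite leq_add2r rank_leq_row.
have leB := rank_leq_row B.
have [uB|nuB] /= := boolP (u <= B)%MS.
  rewrite andbF (addsmx_idPr uB); apply/negbTE.
  by rewrite neq_ltn ltnS leB.
have ltB : (\rank B < \rank (u + B)%MS)%N.
  apply: rank_ltmx; rewrite /ltmx addsmxSr /=.
  by apply: contra nuB; apply: submx_trans (addsmxSl _ _).
have -> : \rank (u + B)%MS = (1 + \rank B)%N by apply/eqP; rewrite eqn_leq leD.
by rewrite eqn_add2l andbT.
Qed.

Lemma card_row_space (F : finFieldType) (m n : nat) (B : 'M[F]_(m, n)) :
  row_free B -> #|[set u : 'rV[F]_n | (u <= B)%MS]| = (#|F| ^ m)%N.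
Proof.
move=> freeB; rewrite -[m in RHS]mul1n -card_mx -(card_imset _ (row_free_inj freeB)).
by apply: eq_card => u; rewrite !inE; apply/submxP/imsetP => -[v];
  [move=> ->; exists v | move=> _ ->; exists v].
Qed.

(** Induction on the rows: those below the top one form a row-free [B], and the top row is then any
    of the [#|F| ^ n - #|F| ^ m] vectors outside the row space of [B]. *)
Lemma card_row_free (F : finFieldType) (m n : nat) :
  #|[set A : 'M[F]_(m, n) | row_free A]| = (\prod_(i < m) (#|F| ^ n - #|F| ^ i))%N.
Proof.
elim: m => [|m IHm].
  rewrite big_ord0 -(cards1 (0 : 'M[F]_(0, n))); apply: eq_card => A.
  by rewrite !inE [A]flatmx0 /row_free mxrank0 !eqxx.
rewrite big_ord_recr /= -IHm -sum_nat_const -[LHS]sum1_card.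
rewrite (partition_big (@dsubmx F 1 m n) (fun B => row_free B)) /=; last first.
  by move=> A; rewrite inE -{1}[A]vsubmxK row_free_col_mx => /andP[].
rewrite [RHS](eq_bigl (fun B : 'M[F]_(m, n) => row_free B)); last first.
  by move=> B; rewrite inE.
apply: eq_bigr => B freeB.
rewrite -(card_row_space freeB) -[n in (_ ^ n)%N]mul1n -card_mx.
rewrite -(cardsC [set u : 'rV[F]_n | (u <= B)%MS]) addKn sum1dep_card.
rewrite -(card_imset _ (can_inj (fun u : 'rV[F]_n => col_mxKu u B))).
apply: eq_card => A; rewrite !inE; apply/andP/imsetP => [[freeA /eqP defB]|].
  exists (usubmx A); last by rewrite -defB vsubmxK.
  by move: freeA; rewrite !inE -{1}[A]vsubmxK row_free_col_mx defB => /andP[].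
case=> u; rewrite !inE => nuB ->.
by rewrite row_free_col_mx freeB nuB col_mxKd.
Qed.

Lemma lker_mulmxr (F : fieldType) (n m : nat) (A : 'M[F]_(n, m))
    (v : 'rV[F]_n) :
  (v \in lker (linfun (mulmxr A))) = (v *m A == 0).
Proof. by rewrite memv_ker lfunE. Qed.

(** [A] represents the projection onto [W^C] along [W], read in coordinates of a basis of [W^C]. *)
Lemma vspace_kernel (F : fieldType) (n m : nat) (W : {vspace 'rV[F]_n}) :
  (\dim W + m = n)%N ->
  exists A : 'M[F]_(n, m), row_full A /\ lker (linfun (mulmxr A)) = W.
Proof.
move=> dimW.
have dimWC : \dim W^C = m by rewrite dimv_compl dimvf /dim /= mul1n; lia.
subst m; set m := \dim W^C in dimW *.
have capWC : (W^C :&: W = 0)%VS by rewrite capvC capv_compl.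
have inD v : v \in (W^C + W)%VS by rewrite addvC addv_complf memvf.
pose X := vbasis W^C.
have freeX : free X := basis_free (vbasisP _).
pose f v := \row_(i < m) coord X i (daddv_pi W^C W v).
have lin_f : linear f.
  by move=> a u v; apply/rowP => i; rewrite !mxE !linearP.
pose fL := GRing.isLinear.Build _ _ _ _ f lin_f.
pose fl : {linear 'rV[F]_n -> 'rV[F]_m} := HB.pack f fL.
have fE v : v *m lin1_mx fl = f v by rewrite mul_rV_lin1.
exists (lin1_mx fl); split.
  (* The basis vectors of [W^C], stacked as rows, form a left inverse of [A]. *)
  apply/row_fullP; exists (\matrix_(i < m) X`_i).
  apply/row_matrixP => i; rewrite row_mul rowK fE row1; apply/rowP => j.
  rewrite !mxE daddv_pi_id ?coord_free //; first by rewrite eqxx eq_sym.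
  by apply: vbasis_mem; apply: mem_nth; rewrite size_tuple.
apply/vspaceP => v; rewrite lker_mulmxr fE; apply/eqP/idP => [f0|vW].
  have := daddv_pi_add capWC (inD v).
  suff -> : daddv_pi W^C W v = 0 by rewrite add0r => <-; apply: memv_pi.
  rewrite (coord_vbasis (memv_pi _ _ v)) big1 // => i _.
  by move/rowP/(_ i): f0; rewrite !mxE => ->; rewrite scale0r.
have := daddv_pi_add capWC (inD v).
rewrite (daddv_pi_id (capv_compl W) vW) -[RHS]add0r => /addIr pi0.
by apply/rowP => i; rewrite !mxE pi0 linear0.
Qed.

(* Every subspace of codimension m is the kernel of at least |GL_m(F)| of the
   n x m matrices of rank m. *)
Lemma card_subspaces_le (F : finFieldType) (n m : nat) : (m <= n)%N ->
  (#|[set W : {vspace 'rV[F]_n} | \dim W == (n - m)%N]|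
    * \prod_(i < m) (#|F| ^ m - #|F| ^ i)
   <= \prod_(i < m) (#|F| ^ n - #|F| ^ i))%N.
Proof.
move=> le_mn; rewrite -!card_row_free -sum_nat_const -[leqRHS]sum1_card.
pose G := [set W : {vspace 'rV[F]_n} | \dim W == (n - m)%N].
pose ker (B : 'M[F]_(m, n)) : {vspace 'rV[F]_n} :=
  lker (linfun (mulmxr B^T)).
rewrite [leqRHS](bigID (fun B => ker B \in G)) /=.
apply: leq_trans (leq_addr _ _).
rewrite (partition_big ker [in G]) /=; last first.
  by move=> B /andP[].
apply: leq_sum => W W_dim; rewrite sum1dep_card.
have [|A [/row_fullP[B BA] kerA]] := @vspace_kernel F n m W.
  by move: W_dim; rewrite inE => /eqP ->; rewrite subnK.
(* Since [B *m A] is the identity, multiplication by [A^T] is injective; it will send GL_m into the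
   fibre of [ker] over [W]. *)
have injA : injective (fun g : 'M[F]_m => g *m A^T).
  apply: (can_inj (g := fun C => C *m B^T)) => g.
  by rewrite -mulmxA -trmx_mul BA trmx1 mulmx1.
rewrite -(card_imset _ injA); apply/subset_leq_card/subsetP => C /imsetP[g].
rewrite inE row_free_unit => g_unit ->; rewrite !inE.
have ker_gA : ker (g *m A^T) = W.
  apply/vspaceP => v; rewrite -kerA !lker_mulmxr trmx_mul trmxK mulmxA.
  apply/eqP/eqP => [|->]; last by rewrite mul0mx.
  by move/(congr1 (mulmx^~ (invmx g^T))); rewrite mulmxK ?unitmx_tr // mul0mx.
rewrite ker_gA eqxx andbT; apply/andP; split; last by move: W_dim; rewrite inE.
apply/row_freeP; exists (B^T *m invmx g).
by rewrite mulmxA -(mulmxA g) -trmx_mul BA trmx1 mulmx1 mulmxV.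
Qed.

(** * Transitivity of GL_n and the number of subspaces through a vector *)

Lemma nz_row_unitmx (F : fieldType) (n : nat) (v : 'rV[F]_n) :
  v != 0 -> exists2 g, g \in unitmx & v = pid_mx 1 *m g.
Proof.
move=> nzv; have rank_v : \rank v = 1%N by rewrite rank_rV nzv.
(* In the rank decomposition of [v] the left factor [col_ebase v] is 1 x 1, a nonzero scalar that
   the right factor absorbs. *)
exists ((col_ebase v) 0 0 *: row_ebase v).
  rewrite -mul_scalar_mx unitmx_mul row_ebase_unit andbT.
  rewrite unitmxE det_scalar unitrX // -det_mx11 -unitmxE; exact: col_ebase_unit.
rewrite -scalemxAr -[LHS]mulmx_ebase rank_v.
by rewrite {1}[col_ebase v]mx11_scalar mul_scalar_mx -scalemxAl.
Qed.

Lemma unitmx_transitive (F : fieldType) (n : nat) (v w : 'rV[F]_n) :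
  v != 0 -> w != 0 -> exists2 g, g \in unitmx & v *m g = w.
Proof.
move=> /nz_row_unitmx[g g_unit ->] /nz_row_unitmx[h h_unit ->].
exists (invmx g *m h); first by rewrite unitmx_mul unitmx_inv g_unit.
by rewrite -mulmxA (mulmxA g) mulmxV // mul1mx.
Qed.

Section SubspaceIncidence.
Variables (F : finFieldType) (n k : nat).
Implicit Types v w : 'rV[F]_n.

Let G := [set W : {vspace 'rV[F]_n} | \dim W == k].
Let D v := #|[set W in G | v \in W]|.

(** An invertible map taking [v] to [w] sends the subspaces through [v] injectively to subspaces
    through [w] of the same dimension. Exchanging [v] and [w] gives equality. *)
Lemma subspaces_through_homogeneous v w : v != 0 -> w != 0 -> (D v <= D w)%N.
Proof.
move=> nzv nzw; have [g g_unit vg] := unitmx_transitive nzv nzw.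
pose h : 'End('rV[F]_n) := linfun (mulmxr g).
have ker_h : lker h == 0%VS.
  apply/lker0P => x y; rewrite !lfunE /=; exact: (can_inj (mulmxK g_unit)).
have inj_h : injective (fun W => h @: W)%VS.
  by move=> W W' /eqP; rewrite eq_limg_ker0 // => /eqP.
rewrite /D -(card_imset _ inj_h); apply/subset_leq_card/subsetP => hW /imsetP[W].
rewrite !inE => /andP[dimW vW] ->; rewrite limg_dim_eq ?(eqP ker_h) ?capv0 //.
have -> : w = h v by rewrite lfunE.
by rewrite dimW memv_img.
Qed.

(** Double counting of the pairs (w, W) with w nonzero in W; by homogeneity [D w] is the same for
    all these w. *)
Lemma card_subspaces_through v : v != 0 ->
  ((#|F| ^ n - 1) * D v = #|G| * (#|F| ^ k - 1))%N.
Proof.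
move=> nzv.
have card_nz (W : {vspace 'rV[F]_n}) :
    #|[set w | w != 0 & w \in W]| = (#|F| ^ \dim W - 1)%N.
  rewrite -card_vspace (cardD1 (0 : 'rV[F]_n) W) mem0v add1n subn1 /=.
  by apply: eq_card => w; rewrite !inE.
have -> : (#|F| ^ n - 1)%N = #|[set w : 'rV[F]_n | w != 0 & w \in fullv]|.
  by rewrite card_nz dimvf /dim /= mul1n.
rewrite -!sum_nat_const.
set nz := [set w | _]; transitivity (\sum_(w in nz) D w)%N.
  apply: eq_bigr => w; rewrite inE => /andP[nzw _]; apply/eqP.
  by rewrite eqn_leq !subspaces_through_homogeneous.
under eq_bigr do rewrite /D -sum1dep_card big_mkcondr.
rewrite exchange_big /=; apply: eq_bigr => W; rewrite inE => /eqP <-.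
rewrite -card_nz -big_mkcondr /= sum1dep_card.
by apply: eq_card => w; rewrite !inE memvf andbT.
Qed.

Lemma subspaces_through_le v : (k <= n)%N -> v != 0 ->
  (#|F| ^ (n - k) * D v <= #|G|)%N.
Proof.
move=> le_kn nzv; have q_gt1 : (1 < #|F|)%N := finNzRing_gt1 F.
have n_gt0 : (0 < n)%N.
  by case: n v nzv => // v; rewrite [v]thinmx0 eqxx.
have qn_gt0 : (0 < #|F| ^ n - 1)%N by rewrite subn_gt0 -(expn0 #|F|) ltn_exp2l.
(* With q = [#|F|], the claim reduces to q^(n-k) (q^k - 1) = q^n - q^(n-k) <= q^n - 1. *)
rewrite -(leq_pmul2l qn_gt0) mulnCA card_subspaces_through //.
rewrite mulnCA mulnC leq_mul2r mulnBr -expnD subnK // muln1.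
by rewrite leq_sub2l ?orbT // expn_gt0 ltnW.
Qed.

(** Exchanging the sums, each x contributes [#|G|] from y = x and at most [#|G|] / [#|F| ^ (n - k)]
    from every other y; the common factor clears this denominator. *)
Lemma sum_coincidences_le (E : {set 'rV[F]_n}) : (k <= n)%N ->
  (#|F| ^ (n - k) * \sum_(W in G) #|[set xy in setX E E | (xy.1 - xy.2)%R \in W]|
   <= #|F| ^ (n - k) * (#|E| * #|G|) + #|E| * ((#|E| - 1) * #|G|))%N.
Proof.
move=> le_kn.
have -> : (\sum_(W in G) #|[set xy in setX E E | (xy.1 - xy.2)%R \in W]| =
    \sum_(x in E) \sum_(y in E) D (x - y)%R)%N.
  under eq_bigr do rewrite -sum1dep_card big_mkcondr.
  rewrite exchange_big [RHS]pair_big /=; apply: eq_big => [xy|xy _].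
    by rewrite inE.
  by rewrite -big_mkcondr sum1dep_card.
rewrite mulnCA -mulnDr big_distrr -sum_nat_const /=; apply: leq_sum => x Ex.
rewrite (bigD1 x) //= mulnDr subrr.
have -> : D 0 = #|G| by apply: eq_card => W; rewrite !inE mem0v andbT.
rewrite leq_add2l big_distrr /= (cardsD1 x E) Ex add1n subn1 /= -sum_nat_const.
rewrite (eq_bigl (mem (E :\ x))) => [|y]; last by rewrite !inE andbC.
apply: leq_sum => y; rewrite !inE => /andP[y_x _].
by apply: subspaces_through_le; rewrite // subr_eq0 eq_sym.
Qed.

End SubspaceIncidence.

(* Cauchy-Schwarz for the sizes of the fibres of f. *)
Lemma card_sqr_le_fibres (T T' : finType) (f : T -> T') (E : {set T}) :
  (#|E| ^ 2 <= #|f @: E| * #|[set xy in setX E E | f xy.1 == f xy.2]|)%N.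
Proof.
pose a c := (\sum_(x in E | f x == c) 1)%N.
have cardE : #|E| = (\sum_(c in f @: E) a c)%N.
  by rewrite -sum1_card (partition_big_imset f).
have -> : #|[set xy in setX E E | f xy.1 == f xy.2]| =
    (\sum_(c in f @: E) a c ^ 2)%N.
  transitivity (\sum_(x in E) a (f x))%N.
    rewrite -sum1dep_card pair_big_dep /=; apply: eq_bigl => xy.
    by rewrite inE andbA (eq_sym (f xy.1)).
  rewrite (partition_big_imset f) /=; apply: eq_bigr => c _.
  rewrite (eq_bigr (fun _ => a c)) => [|x /andP[_ /eqP-> //]].
  by rewrite -[a c in LHS]mul1n -big_distrl.
(* Doubling prepares for 2 a_c a_d <= a_c^2 + a_d^2, applied to each term of the expanded square. *)
rewrite -(leq_pmul2l (isT : 0 < 2)%N) {1}cardE -mulnn big_distrlr /= big_distrr.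
under eq_bigr do rewrite big_distrr /=.
apply: (@leq_trans (\sum_(c in f @: E) \sum_(d in f @: E) (a c ^ 2 + a d ^ 2))).
  by do 2!(apply: leq_sum => ? _); apply: nat_Cauchy.
under eq_bigr do rewrite big_split sum_nat_const /=.
by rewrite big_split /= sum_nat_const -big_distrr /= addnn mul2n.
Qed.

(** * Cosets of a subspace as fibres of [translate W] *)

Section Cosets.
Variables (p n : nat) (W : {vspace 'rV['F_p]_n}).
Implicit Types (x y : 'rV['F_p]_n) (E : {set 'rV['F_p]_n}).

Lemma mem_translate x y : (y \in translate W x) = (y - x \in W).
Proof.
apply/imsetP/idP => [[w wW ->]|yxW]; first by rewrite addrC addKr.
by exists (y - x); rewrite // addrCA subrr addr0.
Qed.

Lemma eq_translate x y : (translate W x == translate W y) = (x - y \in W).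
Proof.
apply/eqP/idP => [eq_xy|xyW].
  by rewrite -mem_translate -eq_xy mem_translate subrr mem0v.
apply/setP => z; rewrite !mem_translate.
by rewrite -(rpredDr (z - x) xyW) addrA subrK.
Qed.

(** A coset meeting [E] is the translate by any of its points in [E]. The image form is what
    [card_sqr_le_fibres] takes. *)
Lemma proj_cosetsE E : proj_cosets W E = translate W @: E.
Proof.
apply/setP => C; apply/imsetP/imsetP => -[x].
  rewrite inE => /set0Pn[y /setIP[Ey]]; rewrite mem_translate -eq_translate.
  by move=> /eqP eq_xy ->; exists y.
move=> Ex ->; exists x => //; rewrite inE; apply/set0Pn; exists x.
by rewrite inE Ex mem_translate subrr mem0v.
Qed.

Lemma card_sqr_le_proj_cosets E :
  (#|E| ^ 2 <=
   #|proj_cosets W E| * #|[set xy in setX E E | (xy.1 - xy.2)%R \in W]|)%N.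
Proof.
rewrite proj_cosetsE; apply: leq_trans (card_sqr_le_fibres (translate W) E) _.
rewrite leq_mul2l; apply/orP; right; apply: eq_leq; apply: eq_card => xy.
by rewrite !inE eq_translate.
Qed.

(** Enlarge [E] to the whole space, whose p^n points split into cosets of size [p ^ \dim W]. *)
Lemma card_proj_cosets_le E : prime p ->
  (#|proj_cosets W E| <= p ^ (n - \dim W))%N.
Proof.
move=> p_pr; have p_gt0 := prime_gt0 p_pr.
rewrite proj_cosetsE.
apply: leq_trans (subset_leq_card (imsetS (translate W) (subsetT E))) _.
have le_dim : (\dim W <= n)%N by have := dimvS (subvf W); rewrite dimvf /dim /= mul1n.
have q_eq : #|'F_p| = p by rewrite card_Fp.
rewrite -(@leq_pmul2r (p ^ \dim W)) ?expn_gt0 ?p_gt0 // -expnD subnK //.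
have <- : #|[set: 'rV['F_p]_n]| = (p ^ n)%N by rewrite cardsT card_mx q_eq mul1n.
rewrite -sum_nat_const -sum1_card (partition_big_imset (translate W)) /=.
apply: leq_sum => _ /imsetP[x _ ->]; rewrite sum1dep_card.
have <- : #|translate W x| = (p ^ \dim W)%N.
  by rewrite card_imset ?card_vspace ?q_eq //; apply: addrI.
apply/eq_leq/eq_card => y.
by rewrite !inE eq_translate -mem_translate.
Qed.
End Cosets.

(** * Passage to the reals and Markov's inequality *)

Lemma card_subspaces_le_gauss_binom (R : realType) (n m p : nat) :
  prime p -> (m <= n)%N -> #|Grass p n (n - m)|%:R <= gauss_binom R p n m.
Proof.
move=> p_pr le_mn.
(* For i < m <= j the subtraction in [nat] does not truncate, so it agrees with the real one. *)
have prodE j : (m <= j)%N ->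
    \prod_(i < m) (p%:R ^+ j - p%:R ^+ i) = (\prod_(i < m) (p ^ j - p ^ i))%N%:R :> R.
  move=> le_mj; rewrite natr_prod; apply: eq_bigr => i _.
  rewrite natrB ?natrX // leq_pexp2l ?prime_gt0 //.
  exact: leq_trans (ltnW (ltn_ord i)) le_mj.
rewrite /gauss_binom !prodE // ler_pdivlMr.
  rewrite -natrM ler_nat.
  by have := @card_subspaces_le 'F_p n m le_mn; rewrite card_Fp.
rewrite ltr0n prodn_gt0 // => i.
by rewrite subn_gt0 ltn_exp2l ?prime_gt1.
Qed.

(** Markov's inequality for the counting measure on [G], free of division by [c]. *)
Lemma card_mul_le_sum (R : numDomainType) (T : finType) (G : {set T})
    (Q : pred T) (f : T -> R) (c : R) :
  {in G, forall W, 0 <= f W} -> {in G, forall W, Q W -> c <= f W} ->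
  #|[set W in G | Q W]|%:R * c <= \sum_(W in G) f W.
Proof.
move=> f_ge0 f_ge; rewrite mulr_natl -sumr_const.
rewrite (eq_bigl (fun W => (W \in G) && Q W)) => [|W]; last by rewrite inE.
rewrite big_mkcondr; apply: ler_sum => W GW.
by case: ifP => [/f_ge|_]; [apply | apply: f_ge0].
Qed.

(** * Second-moment estimates, where [P], [e], [a], [q] abstract |pi^W(E)|, e(W), |E| and p^m *)

Section SecondMoment.
Variables (R : realFieldType) (T : finType) (G : {set T}) (P e : T -> nat).
Variables (a q : nat).
Hypothesis a_gt0 : (0 < a)%N.
Hypothesis cauchy : {in G, forall W, a ^ 2 <= P W * e W}%N.
Hypothesis sum_e :
  (q * \sum_(W in G) e W <= q * (a * #|G|) + a * ((a - 1) * #|G|))%N.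

Let sum_eR : q%:R * \sum_(W in G) (e W)%:R <=
  q%:R * (a%:R * #|G|%:R) + a%:R * ((a%:R - 1) * #|G|%:R) :> R.
Proof.
by have := sum_e; rewrite -(ler_nat R) natrD !natrM natr_sum natrB.
Qed.

Let cauchyR (W : T) (N : R) : W \in G -> (P W)%:R <= N ->
  a%:R ^+ 2 <= N * (e W)%:R.
Proof.
move=> GW PN; apply: le_trans (ler_wpM2r (ler0n _ _) PN).
by rewrite -natrX -natrM ler_nat cauchy.
Qed.

(** If P W <= N < a/2, then N (e W - a) >= a^2 - N a >= a^2/2. Keeping N as a factor instead of
    dividing by it covers N = 0. *)
Lemma card_small_le_half (N : R) : {in G, forall W, a <= e W}%N ->
  0 <= N < 2^-1 * a%:R ->
  #|[set W in G | (P W)%:R <= N]|%:R * q%:R <= 2 * N * #|G|%:R.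
Proof.
move=> diag /andP[N_ge0 N_lt]; have a0 : 0 < a%:R :> R by rewrite ltr0n.
set t := #|_|%:R.
have : t * (a%:R ^+ 2 / 2) <= \sum_(W in G) N * ((e W)%:R - a%:R).
  apply: card_mul_le_sum => W GW.
    by rewrite mulr_ge0 // subr_ge0 ler_nat diag.
  move=> PN; have := cauchyR GW PN; nra.
rewrite -big_distrr /= sumrB sumr_const -mulr_natr.
move: sum_eR; set S := \sum_(_ in _) _; set g := #|G|%:R => leS let'.
have g0 : 0 <= g by exact: ler0n.
have q0 : 0 <= q%:R :> R by exact: ler0n.
have step : q%:R * (S - a%:R * g) <= a%:R ^+ 2 * g by nra.
rewrite -(ler_pM2r (exprn_gt0 2 a0)).
have := ler_wpM2l N_ge0 step; have := ler_wpM2l q0 let'.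
by nra.
Qed.

(** P W <= q makes q e W - a^2 nonnegative, and P W <= delta q gives delta (q e W - a^2) >= a^2 (1 -
    delta). *)
Lemma card_small_le_proportion (delta : R) : {in G, forall W, P W <= q}%N ->
  0 < delta ->
  #|[set W in G | (P W)%:R <= delta * q%:R]|%:R * (1 - delta) * a%:R
    <= delta * q%:R * #|G|%:R.
Proof.
move=> P_le d0; have a0 : 0 < a%:R :> R by rewrite ltr0n.
set t := #|_|%:R.
have : t * (a%:R ^+ 2 * (1 - delta)) <=
    \sum_(W in G) delta * (q%:R * (e W)%:R - a%:R ^+ 2).
  apply: card_mul_le_sum => W GW.
    by rewrite mulr_ge0 ?(ltW d0) // subr_ge0 cauchyR // ler_nat P_le.
  move=> PN; have := cauchyR GW PN; lra.
rewrite -big_distrr /= sumrB sumr_const -mulr_natr -big_distrr /=.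
move: sum_eR; set S := \sum_(_ in _) _; set g := #|G|%:R => leS let'.
have g0 : 0 <= g by exact: ler0n.
(* The off-diagonal term a (a - 1) g of [sum_eR] is absorbed by a^2 g, leaving only the diagonal q a
   g. *)
have step : q%:R * S - a%:R ^+ 2 * g <= q%:R * a%:R * g by nra.
rewrite -(ler_pM2r a0).
have := ler_wpM2l (ltW d0) step.
by nra.
Qed.

End SecondMoment.

Theorem theorem1p2 (R : realType) (n m p : nat)
  (hmn : (1 <= m <= n - 1)%N) (hp : prime p)
  (hlarge : p%:R ^+ (m * (n - m)) <= gauss_binom R p n m
            <= 2 * p%:R ^+ (m * (n - m)))
  (E : {set 'rV['F_p]_n}) (hE : E != set0) :
  (forall N : R, 0 <= N < 2^-1 * #|E|%:R ->
     #|[set W in Grass p n (n - m) | #|proj_cosets W E|%:R <= N]|%:R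
       <= 4 * p%:R ^+ ((n - m) * m - m) * N)
  /\
  (forall delta : R, 0 < delta < 1 ->
     #|[set W in Grass p n (n - m) |
          #|proj_cosets W E|%:R <= delta * p%:R ^+ m]|%:R
       <= 2 * (delta / (1 - delta)) * p%:R ^+ (m * (n - m) + m)
            * #|E|%:R^-1).
Proof.
have le_mn : (m <= n)%N by lia.
have p_gt0 : (0 < p)%N := prime_gt0 hp.
have E_gt0 : (0 < #|E|)%N by rewrite card_gt0.
set G := Grass p n (n - m).
have dimG W : W \in G -> (n - \dim W = m)%N by rewrite inE => /eqP ->; lia.
pose e (W : {vspace 'rV['F_p]_n}) :=
  #|[set xy in setX E E | (xy.1 - xy.2)%R \in W]|.
have cauchy : {in G, forall W, #|E| ^ 2 <= #|proj_cosets W E| * e W}%N.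
  by move=> W _; apply: card_sqr_le_proj_cosets.
have sum_e : (p ^ m * \sum_(W in G) e W
    <= p ^ m * (#|E| * #|G|) + #|E| * ((#|E| - 1) * #|G|))%N.
  have := @sum_coincidences_le 'F_p n (n - m) E (leq_subr _ _).
  by rewrite card_Fp // subKn.
have diag : {in G, forall W, #|E| <= e W}%N.
  move=> W _; pose d (x : 'rV['F_p]_n) := (x, x).
  have inj_d : injective d by move=> x y [].
  rewrite -(card_imset _ inj_d); apply/subset_leq_card/subsetP => xy /imsetP[x Ex ->].
  by rewrite !inE /= Ex subrr mem0v.
have cosets_le : {in G, forall W, #|proj_cosets W E| <= p ^ m}%N.
  by move=> W GW; rewrite -(dimG W GW) card_proj_cosets_le.
(* The upper half of [hlarge] supplies the factor 2 in (b) and one of the two factors 2 in the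
   constant 4 of (a). *)
have G_le : #|G|%:R <= 2 * p%:R ^+ (m * (n - m)) :> R.
  apply: le_trans (card_subspaces_le_gauss_binom R hp le_mn) _.
  by case/andP: hlarge.
have q_gt0 : 0 < p%:R ^+ m :> R by rewrite exprn_gt0 ?ltr0n.
split=> [N N_bnd|delta /andP[d_gt0 d_lt1]].
  have := card_small_le_half E_gt0 cauchy sum_e diag N_bnd.
  rewrite natrX => le_t; rewrite -(ler_pM2r q_gt0); apply: le_trans le_t _.
  have -> : 4 * p%:R ^+ ((n - m) * m - m) * N * p%:R ^+ m
      = 2 * N * (2 * p%:R ^+ (m * (n - m))) :> R.
    (* The exponent does not truncate: n - m >= 1 gives (n - m) m >= m. *)
    have -> : (m * (n - m) = (n - m) * m - m + m)%N by nia.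
    by rewrite exprD; ring.
  by case/andP: N_bnd => N_ge0 _; rewrite ler_wpM2l ?mulr_ge0.
have d1_gt0 : 0 < 1 - delta by rewrite subr_gt0.
have a_gt0 : 0 < #|E|%:R :> R by rewrite ltr0n.
have := card_small_le_proportion E_gt0 cauchy sum_e cosets_le d_gt0.
rewrite natrX => le_t.
rewrite -(ler_pM2r d1_gt0) -(ler_pM2r a_gt0); apply: le_trans le_t _.
have -> : 2 * (delta / (1 - delta)) * p%:R ^+ (m * (n - m) + m) * #|E|%:R^-1
      * (1 - delta) * #|E|%:R
    = delta * p%:R ^+ m * (2 * p%:R ^+ (m * (n - m))).
  by rewrite exprD; field; rewrite !gt_eqF.
by rewrite ler_wpM2l // mulr_ge0 // ltW.
Qed.
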